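(* Let $\chi$ be transcendental over the field $K$, and let $\nu$ be a valuation on $K(\chi)$ or a pseudo-valuation of $K[\chi]$. Every abstract key polynomial $\Phi$ for $\nu$ is a key polynomial for $\nu$ (where, if $\nu$ is a pseudo-valuation, $\deg(\Phi)$ is assumed lower than the degree of a generator of the ideal $\{f\in K[\chi]:\nu(f)=\infty\}$ when that ideal is nonzero).
   Context: A pseudo-valuation $\nu$ of $K[\chi]$ is a map onto a linearly ordered abelian group together with $\infty$ having the properties of a valuation ($\nu(fg)=\nu(f)+\nu(g)$, $\nu(f+g)\ge\min(\nu(f),\nu(g))$, $\nu(0)=\infty$) except that $\nu(f)=\infty$ need not imply $f=0$; $\{f:\nu(f)=\infty\}$ is then a prime ideal. It is assumed that $\nu K$ has finite rank. For a polynomial $f$ and $i\ge1$, $f_{(i)}=\frac{1}{i!}f^{(i)}$ is the $i$-th formal (Hasse) derivative, the division by $i!$ being done formally before reducing modulo the characteristic. For $f\ne0$, $\varepsilon_\nu(f)$ is the maximum over $i\ge1$ of $\frac{\nu(f)-\nu(f_{(i)})}{i}$ (in the divisible hull of the value group, with value $-\infty$ when $\nu(f_{(i)})=\infty$). A (non constant) polynomial $\Phi$ is an abstract key polynomial for $\nu$ if it is monic and for every nonzero $f\in K[\chi]$ such that $\varepsilon_\nu(f)\ge\varepsilon_\nu(\Phi)$ we have $\deg(f)\ge\deg(\Phi)$. For $\Phi$ monic of degree $d\ge1$ and $f,g\in K_{d-1}[\chi]$ (polynomials of degree at most $d-1$), let $q(f,g)$ and $r(f,g)$ be the quotient and remainder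 of the euclidean division of $fg$ by $\Phi$. $\Phi$ is a key polynomial for $\nu$ if for all nonzero $f,g\in K_{d-1}[\chi]$ we have $\nu(fg)=\nu(r(f,g))<\nu(q(f,g)\Phi)$. *)

(* Defs.v *)
From HB Require Import structures.
From mathcomp Require Import all_boot all_order all_algebra generic_quotient.
From mathcomp Require Import zify classical_sets cardinality.

Set Implicit Arguments.
Unset Strict Implicit.
Unset Printing Implicit Defensive.

Import Order.TTheory GRing.Theory Num.Theory.
Local Open Scope ring_scope.

(** * Linearly ordered abelian groups *)

(* Totality is a field of the mixin: a join with [Order.Total] would have to be
   declared below [Num.RealDomain]. *)
HB.mixin Record POrderedZmodule_isOrderedGroup G of Num.POrderedZmodule G := {
  ogrp_le_total : total (<=%R : rel G);
  ogrp_le_add2l : forall z x y : G, x <= y -> z + x <= z + y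
}.

#[short(type="orderedGroupType")]
HB.structure Definition OrderedGroup :=
  { G of POrderedZmodule_isOrderedGroup G & Num.POrderedZmodule G }.

Section OrderedGroupTheory.
Variable G : orderedGroupType.
Implicit Types x y z : G.

Lemma ogrp_leD2l z : {mono +%R z : x y / x <= y}.
Proof.
move=> x y; apply/idP/idP => [/(ogrp_le_add2l (- z))|]; last exact: ogrp_le_add2l.
by rewrite !addKr.
Qed.

Lemma ogrp_leD x y z t : x <= y -> z <= t -> x + z <= y + t.
Proof.
move=> xy zt; apply: (@le_trans _ _ (x + t)); first by rewrite ogrp_leD2l.
by rewrite ![_ + t]addrC ogrp_leD2l.
Qed.

Lemma ogrp_ltMn n x y : x < y -> x *+ n.+1 < y *+ n.+1.
Proof.
move=> xy; elim: n => [|n IHn]; first by rewrite !mulr1n.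
rewrite ![_ *+ n.+2]mulrS; apply: (@lt_le_trans _ _ (x + y *+ n.+1)).
  by rewrite (leW_mono (ogrp_leD2l x)).
by rewrite ogrp_leD // ltW.
Qed.

Lemma ogrp_leMn n : {mono (fun x => x *+ n.+1) : x y / x <= y}.
Proof.
move=> x y; have [->|xNy] := eqVneq x y; first by rewrite !lexx.
case/orP: (ogrp_le_total x y) => [xy|yx].
  by rewrite xy ltW // ogrp_ltMn // lt_neqAle xNy.
have ltyx : y < x by rewrite lt_neqAle eq_sym xNy.
by rewrite (lt_geF ltyx) (lt_geF (ogrp_ltMn n ltyx)).
Qed.

End OrderedGroupTheory.

(** * The divisible hull of a linearly ordered abelian group *)

Section DivHull.
Variable G : orderedGroupType.

(* The pair (x, n) stands for the fraction x / (n + 1). *)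
Local Notation frac := (G * nat)%type.
Implicit Types u v w : frac.

Definition dh_equivf u v := u.1 *+ v.2.+1 == v.1 *+ u.2.+1.
Definition dh_lef u v := u.1 *+ v.2.+1 <= v.1 *+ u.2.+1.
Definition dh_addf u v : frac :=
  (u.1 *+ v.2.+1 + v.1 *+ u.2.+1, (u.2.+1 * v.2.+1).-1).
Definition dh_oppf u : frac := (- u.1, u.2).

Lemma dh_addfE2 u v : (dh_addf u v).2.+1 = (u.2.+1 * v.2.+1)%N.
Proof. exact: prednK. Qed.

Lemma dh_lef_trans : transitive dh_lef.
Proof.
move=> v u w; rewrite /dh_lef => uv vw; rewrite -(ogrp_leMn v.2).
apply: (@le_trans _ _ (v.1 *+ u.2.+1 *+ w.2.+1)).
  by rewrite mulrnAC ogrp_leMn.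
by rewrite mulrnAC [leRHS]mulrnAC ogrp_leMn.
Qed.

Lemma dh_equivfE u v : dh_equivf u v = dh_lef u v && dh_lef v u.
Proof. by rewrite /dh_equivf /dh_lef eq_le. Qed.

Lemma dh_equivf_refl : reflexive dh_equivf.
Proof. by move=> u; apply: eqxx. Qed.

Lemma dh_equivf_sym : symmetric dh_equivf.
Proof. by move=> u v; rewrite /dh_equivf eq_sym. Qed.

Lemma dh_equivf_trans : transitive dh_equivf.
Proof.
move=> v u w; rewrite !dh_equivfE => /andP[uv vu] /andP[vw wv].
by rewrite (dh_lef_trans uv vw) (dh_lef_trans wv vu).
Qed.

Canonical dh_equivf_equiv :=
  EquivRel dh_equivf dh_equivf_refl dh_equivf_sym dh_equivf_trans.

Definition divhull := {eq_quot dh_equivf}%qT.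
HB.instance Definition _ : EqQuotient _ dh_equivf divhull :=
  EqQuotient.on divhull.
HB.instance Definition _ := Choice.on divhull.

Definition dh_ofrac u : divhull := (\pi_(divhull) u)%qT.

Lemma dh_ofracE u v : (dh_ofrac u == dh_ofrac v) = dh_equivf u v.
Proof. exact: (eqmodE _ u v). Qed.

Lemma dh_reprfK (a : divhull) : dh_ofrac (repr a) = a.
Proof. exact: reprK. Qed.

Lemma dh_repr_ofrac u : dh_equivf (repr (dh_ofrac u)) u.
Proof. by rewrite -dh_ofracE dh_reprfK. Qed.

Definition dh_le (a b : divhull) := dh_lef (repr a) (repr b).
Definition dh_add (a b : divhull) := dh_ofrac (dh_addf (repr a) (repr b)).
Definition dh_opp (a : divhull) := dh_ofrac (dh_oppf (repr a)).
Definition dh_zero := dh_ofrac (0, 0).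

Lemma dh_le_ofrac u v : dh_le (dh_ofrac u) (dh_ofrac v) = dh_lef u v.
Proof.
have := dh_repr_ofrac u; have := dh_repr_ofrac v; rewrite !dh_equivfE.
move=> /andP[v1 v2] /andP[u1 u2]; apply/idP/idP => uv.
  exact: dh_lef_trans u2 (dh_lef_trans uv v1).
exact: dh_lef_trans u1 (dh_lef_trans uv v2).
Qed.

Lemma dh_le_refl : reflexive dh_le.
Proof. by move=> a; apply: lexx. Qed.

Lemma dh_le_anti : antisymmetric dh_le.
Proof.
move=> a b; rewrite -[a]dh_reprfK -[b]dh_reprfK !dh_le_ofrac -dh_equivfE -dh_ofracE.
by move/eqP.
Qed.

Lemma dh_le_trans : transitive dh_le.
Proof. by move=> b a c; apply: dh_lef_trans. Qed.

Lemma dh_le_total : total dh_le.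
Proof. by move=> a b; apply: ogrp_le_total. Qed.

HB.instance Definition _ :=
  Order.Le_isPOrder.Build ring_display divhull dh_le_refl dh_le_anti dh_le_trans.

Lemma dh_equivf_add u u' v v' :
  dh_equivf u u' -> dh_equivf v v' -> dh_equivf (dh_addf u v) (dh_addf u' v').
Proof.
rewrite /dh_equivf !dh_addfE2 /= => /eqP uu' /eqP vv'; apply/eqP.
rewrite !mulrnDl -!mulrnA; congr (_ + _).
  transitivity (u.1 *+ u'.2.+1 *+ (v.2.+1 * v'.2.+1)); last rewrite uu';
    by rewrite -mulrnA; congr (_ *+ _); lia.
transitivity (v.1 *+ v'.2.+1 *+ (u.2.+1 * u'.2.+1)); last rewrite vv';
  by rewrite -mulrnA; congr (_ *+ _); lia.
Qed.

Lemma dh_add_ofrac u v : dh_add (dh_ofrac u) (dh_ofrac v) = dh_ofrac (dh_addf u v).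
Proof. by apply/eqP; rewrite dh_ofracE dh_equivf_add ?dh_repr_ofrac. Qed.

Lemma dh_opp_ofrac u : dh_opp (dh_ofrac u) = dh_ofrac (dh_oppf u).
Proof.
apply/eqP; rewrite dh_ofracE /dh_equivf /= !mulNrn eqr_opp.
exact: dh_repr_ofrac.
Qed.

Lemma dh_addA : associative dh_add.
Proof.
move=> a b c; rewrite -[a]dh_reprfK -[b]dh_reprfK -[c]dh_reprfK.
move: (repr a) (repr b) (repr c) => u v w; rewrite !dh_add_ofrac.
apply/eqP; rewrite dh_ofracE /dh_equivf !dh_addfE2 /= !dh_addfE2 mulnA; apply/eqP.
congr (_ *+ _); rewrite !mulrnDl -!mulrnA addrA.
by congr (_ + _ + _); congr (_ *+ _); rewrite mulnC.
Qed.

Lemma dh_addC : commutative dh_add.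
Proof.
move=> a b; rewrite -[a]dh_reprfK -[b]dh_reprfK !dh_add_ofrac.
by rewrite /dh_addf addrC mulnC.
Qed.

Lemma dh_add0 : left_id dh_zero dh_add.
Proof.
move=> a; rewrite -[a]dh_reprfK dh_add_ofrac /dh_addf mul0rn add0r mul1n.
by case: (repr a).
Qed.

Lemma dh_addN : left_inverse dh_zero dh_opp dh_add.
Proof.
move=> a; rewrite -[a]dh_reprfK dh_opp_ofrac dh_add_ofrac; apply/eqP.
by rewrite dh_ofracE /dh_equivf /dh_addf /= mulNrn addNr !mul0rn.
Qed.

HB.instance Definition _ := GRing.isZmodule.Build
  divhull dh_addA dh_addC dh_add0 dh_addN.

Lemma dh_le_add2l (c a b : divhull) : a <= b -> c + a <= c + b.
Proof.
rewrite -[c]dh_reprfK -[a]dh_reprfK -[b]dh_reprfK.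
move: (repr a) (repr b) (repr c) => u v w.
suff: dh_lef u v -> dh_lef (dh_addf w u) (dh_addf w v).
  move=> H; change (dh_le (dh_ofrac u) (dh_ofrac v) ->
    dh_le (dh_add (dh_ofrac w) (dh_ofrac u)) (dh_add (dh_ofrac w) (dh_ofrac v))).
  by rewrite !dh_add_ofrac !dh_le_ofrac.
rewrite /dh_lef !dh_addfE2 /= !mulrnDl -!mulrnA => uv.
rewrite [X in _ <= X + _](_ : _ = w.1 *+ (u.2.+1 * (w.2.+1 * v.2.+1))); last first.
  by congr (_ *+ _); lia.
rewrite ogrp_leD2l [leRHS](_ : _ = v.1 *+ (u.2.+1 * (w.2.+1 * w.2.+1))); last first.
  by congr (_ *+ _); lia.
rewrite [leLHS](_ : _ = u.1 *+ (v.2.+1 * (w.2.+1 * w.2.+1))); last first.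
  by congr (_ *+ _); lia.
by rewrite !mulrnA !ogrp_leMn.
Qed.

End DivHull.

Section DivHullTheory.
Variable G : orderedGroupType.

HB.instance Definition _ := POrderedZmodule_isOrderedGroup.Build
  (divhull G) (@dh_le_total G) (@dh_le_add2l G).

(* The fraction x / n, for n > 0. *)
Definition divfrac (x : G) (n : nat) : divhull G := dh_ofrac (x, n.-1).

Lemma le_divfrac (x y : G) (m n : nat) : (0 < m)%N -> (0 < n)%N ->
  (divfrac x m <= divfrac y n) = (x *+ n <= y *+ m).
Proof. by case: m n => [|m] [|n] // _ _; apply: dh_le_ofrac. Qed.

Lemma divfracP (a : divhull G) : exists x n, (0 < n)%N /\ a = divfrac x n.
Proof.
by exists (repr a).1, (repr a).2.+1; rewrite /divfrac -surjective_pairing dh_reprfK.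
Qed.

Lemma divfracD (x y : G) n : (0 < n)%N ->
  divfrac x n + divfrac y n = divfrac (x + y) n.
Proof.
case: n => // n _; rewrite [LHS]dh_add_ofrac; apply/eqP.
rewrite dh_ofracE /dh_equivf dh_addfE2 /= -mulrnDl.
by rewrite -!mulrnA; apply/eqP; congr (_ *+ _); lia.
Qed.

Lemma divfracMn (x : G) n : (0 < n)%N -> divfrac x n *+ n = divfrac x 1.
Proof.
move=> n0; have -> k : divfrac x n *+ k = divfrac (x *+ k) n.
  elim: k => [|k IHk]; last by rewrite !mulrS IHk divfracD.
  by rewrite !mulr0n; apply/eqP; rewrite [_ == _]dh_ofracE /dh_equivf !mul0rn.
case: n n0 => // n _; apply/eqP.
by rewrite dh_ofracE /dh_equivf /= mulr1n.
Qed.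

End DivHullTheory.

(** * Adjoining infinite elements *)

Inductive with_top (G : Type) := Fin of G | Inf.
Arguments Inf {G}.

Section WithTop.
Variable G : orderedGroupType.
Implicit Types a b c : with_top G.

Definition with_top_option a : option G := if a is Fin x then Some x else None.
Definition option_with_top (o : option G) : with_top G :=
  if o is Some x then Fin x else Inf.
Lemma with_top_optionK : cancel with_top_option option_with_top.
Proof. by case. Qed.

HB.instance Definition _ :=
  Choice.copy (with_top G) (can_type with_top_optionK).

Definition top_le a b :=
  match a, b with
  | _, Inf => true
  | Inf, Fin _ => false
  | Fin x, Fin y => x <= y
  end.

Definition top_add a b :=
  if (a, b) is (Fin x, Fin y) then Fin (x + y) else Inf.

Lemma top_le_refl : reflexive top_le.
Proof. by case=> /=. Qed.

Lemma top_le_anti : antisymmetric top_le.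
Proof. by move=> [x|] [y|] //=; rewrite -eq_le => /eqP->. Qed.

Lemma top_le_trans : transitive top_le.
Proof. by move=> [y|] [x|] [z|] //=; apply: le_trans. Qed.

HB.instance Definition _ := Order.Le_isPOrder.Build ring_display
  (with_top G) top_le_refl top_le_anti top_le_trans.

Lemma top_le_total : total (<=%R : rel (with_top G)).
Proof. by move=> [x|] [y|] //; apply: ogrp_le_total. Qed.

End WithTop.

Inductive with_ends (G : Type) := EFin of G | PInf | NInf.
Arguments PInf {G}.
Arguments NInf {G}.

Section WithEnds.
Variable G : orderedGroupType.
Implicit Types a b c : with_ends G.

Definition with_ends_sum a : G + bool :=
  match a with EFin x => inl x | PInf => inr true | NInf => inr false end.
Definition sum_with_ends (s : G + bool) : with_ends G :=
  match s with inl x => EFin x | inr b => if b then PInf else NInf end.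
Lemma with_ends_sumK : cancel with_ends_sum sum_with_ends.
Proof. by case. Qed.

HB.instance Definition _ :=
  Choice.copy (with_ends G) (can_type with_ends_sumK).

Definition ends_le a b :=
  match a, b with
  | NInf, _ | _, PInf => true
  | EFin x, EFin y => x <= y
  | _, _ => false
  end.

Lemma ends_le_refl : reflexive ends_le.
Proof. by case=> /=. Qed.

Lemma ends_le_anti : antisymmetric ends_le.
Proof. by move=> [x||] [y||] //=; rewrite -eq_le => /eqP->. Qed.

Lemma ends_le_trans : transitive ends_le.
Proof. by move=> [y||] [x||] [z||] //=; apply: le_trans. Qed.

HB.instance Definition _ := Order.Le_isPOrder.Build ring_display
  (with_ends G) ends_le_refl ends_le_anti ends_le_trans.

Lemma ends_le_total : total (<=%R : rel (with_ends G)).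
Proof. by move=> [x||] [y||] //; apply: ogrp_le_total. Qed.

End WithEnds.

(** * Valuations and pseudo-valuations *)

Section Valuations.
Variables (R : comNzRingType) (G : orderedGroupType).

(* Surjectivity onto [with_top G] rules out the constant map [Inf], and forces
   [G] to be the value group when [R] is a field. *)
Definition pseudo_valuation (nu : R -> with_top G) : Prop :=
  [/\ forall a, exists x, nu x = a,
      nu 0 = Inf,
      forall x y, nu (x * y) = top_add (nu x) (nu y)
    & forall x y, Num.min (nu x) (nu y) <= nu (x + y)].

Definition valuation (nu : R -> with_top G) : Prop :=
  pseudo_valuation nu /\ (forall x, nu x = Inf -> x = 0).

End Valuations.

Section Rank.
Variable G : orderedGroupType.
Local Open Scope classical_set_scope.

Definition isolated_subgroup (H D : set G) : Prop :=
  [/\ D `<=` H, D 0, forall x y, D x -> D y -> D (x - y)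
    & forall x y, D y -> H x -> 0 <= x -> x <= y -> D x].

(* The rank of H is the number of its isolated subgroups other than H. *)
Definition finite_rank (H : set G) : Prop := finite_set (isolated_subgroup H).

End Rank.

(** * Key polynomials *)

Section KeyPolynomials.
Variables (K : fieldType) (G : orderedGroupType).
Implicit Types (nu : {poly K} -> with_top G) (f g Phi : {poly K}).

Definition base_value_group nu : set G :=
  [set v | exists c : K, nu c%:P = Fin v]%classic.

(* (nu f - nu (f_(i))) / i, for i > 0; [f^`N(i)] is the i-th Hasse derivative. *)
Definition slope nu f (i : nat) : with_ends (divhull G) :=
  match nu f, nu f^`N(i) with
  | _, Inf => NInf
  | Inf, Fin _ => PInf
  | Fin x, Fin y => EFin (divfrac (x - y) i)
  end.

(* The indices [i >= size f], where [f^`N(i) = 0], would only contribute [NInf]. *)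
Definition epsilon nu f : with_ends (divhull G) :=
  \big[Num.max/NInf]_(1 <= i < size f) slope nu f i.

Definition abstract_key_polynomial nu Phi : Prop :=
  [/\ (1 < size Phi)%N, Phi \is monic
    & forall f, f != 0 -> epsilon nu Phi <= epsilon nu f ->
        (size Phi <= size f)%N].

Definition key_polynomial nu Phi : Prop :=
  [/\ (1 < size Phi)%N, Phi \is monic
    & forall f g, f != 0 -> g != 0 ->
        (size f < size Phi)%N -> (size g < size Phi)%N ->
        nu (f * g) = nu ((f * g) %% Phi) /\
        nu ((f * g) %% Phi) < nu ((f * g) %/ Phi * Phi)].

Definition generates_support nu g : Prop :=
  forall f, nu f = Inf <-> g %| f.

Definition restrict_to_poly (w : {fraction {poly K}} -> with_top G) :
    {poly K} -> with_top G :=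
  fun f => w (tofrac f).

End KeyPolynomials.

(* Main.v *)
(** Write [eps(Phi) = x / n] and weigh the Hasse derivative [f_(i)] by
    [n nu(f_(i)) + i x].  The last index at which this weight is minimal adds up
    under products, and for [Phi] it is positive; so for any [q] some [i > 0]
    satisfies [n nu((q Phi)_(i)) + i x <= n nu(q Phi)].  On the other hand a
    nonzero [f] of degree less than [Phi] has [eps(f) < eps(Phi)], that is,
    [n nu(f_(i)) + i x > n nu(f)] for all [i > 0], and by the Leibniz rule the
    same holds for a product of two such polynomials.  If [fg = q Phi + r] with
    [nu(q Phi)] at most [nu(fg)] and [nu(r)], then [(q Phi)_(i) = (fg)_(i) - r_(i)]
    yields a contradiction. *)

Require Import Defs.
From HB Require Import structures.
From mathcomp Require Import all_boot all_order all_algebra.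
From mathcomp Require Import classical_sets cardinality.
From mathcomp Require Import boolp zify ring.
Local Open Scope ring_scope.

Set Implicit Arguments.
Unset Strict Implicit.
Unset Printing Implicit Defensive.

Import Order.TTheory GRing.Theory.

(** * Total orders and the Leibniz rule for Hasse derivatives *)

HB.instance Definition _ (G : orderedGroupType) :=
  Order.POrder_isTotal.Build ring_display (with_top G) (@top_le_total G).
HB.instance Definition _ (G : orderedGroupType) :=
  Order.POrder_isTotal.Build ring_display (with_ends G) (@ends_le_total G).

Lemma nderivnM (R : comNzRingType) (p q : {poly R}) n :
  (p * q)^`N(n) = \sum_(i < n.+1) p^`N(i) * q^`N(n - i).
Proof.
elim/poly_ind: p n => [|p c IHp] n.
  rewrite mul0r linear0 big1 // => i _.
  by rewrite linear0 mul0r.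
case: n => [|n]; first by rewrite big_ord1 !nderivn0.
have Epq : (p * q)^`N(n.+1) =
    p * q^`N(n.+1) + \sum_(i < n.+1) p^`N(i.+1) * q^`N(n - i).
  by rewrite IHp big_ord_recl nderivn0.
rewrite big_ord_recl subn0 nderivn0.
under eq_bigr => i _ do rewrite lift0 subSS nderivnMXaddC mulrDl mulrAC.
rewrite big_split /= -IHp -mulr_suml mulrDl nderivnD mul_polyC nderivnZ -mul_polyC.
(* The zero constant term brings [p * q * 'X] into the form that [nderivnMXaddC] expects. *)
rewrite mulrAC -[p * q * 'X]addr0 -[0]/(0%:P) nderivnMXaddC Epq; ring.
Qed.

(** * Inequalities and minima among values with infinity *)

Section WithTopTheory.
Variable G : orderedGroupType.
Implicit Types (a b : G) (u v : with_top G).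

Lemma top_add_lt_le a b u v :
  Fin a < u -> Fin b <= v -> Fin (a + b) < top_add u v.
Proof.
case: u v => [x|] [y|] //; rewrite !ltNge => xa yb; apply: contra xa => ab.
have {}ab : x + y <= a + b := ab.
rewrite -[_ <= _]/(x <= a) -(ogrp_leD2l b) ![b + _]addrC.
by apply: le_trans ab; rewrite ogrp_leD2l.
Qed.

Lemma top_add_le_lt a b u v :
  Fin a <= u -> Fin b < v -> Fin (a + b) < top_add u v.
Proof.
move=> au bv; have := top_add_lt_le bv au; rewrite addrC.
by case: u v {au bv} => [x|] [y|] //; rewrite /top_add [x + y]addrC.
Qed.

Lemma last_min (h : nat -> with_top G) n :
  h 0 <> Inf -> (forall j, (n < j)%N -> h j = Inf) ->
  exists i c, [/\ h i = Fin c, forall j, Fin c <= h j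
    & forall j, (i < j)%N -> Fin c < h j].
Proof.
move=> h0 hn.
have [m [hm1 hm2 hm3]] : exists m, [/\ h m <= h 0,
    forall j, (j <= n)%N -> h m <= h j
  & forall j, (j <= n)%N -> (m < j)%N -> h m < h j].
  elim: n {hn} => [|n [m [m0 m1 m2]]].
    exists 0; split=> // j; rewrite leqn0 => /eqP-> //.
  (* Ties go to the later index, which makes the minimiser the last one. *)
  have [le|lt] := leP (h n.+1) (h m).
    exists n.+1; split; first exact: le_trans m0.
      by move=> j; rewrite leq_eqVlt => /orP[/eqP->//|/m1]; apply: le_trans.
    by move=> j jn /leq_trans/(_ jn); rewrite ltnn.
  exists m; split=> // j; rewrite leq_eqVlt => /orP[/eqP->//|]; last exact: m2.
    exact: ltW.
  exact: m1.
case hm : (h m) => [c|]; last by case: (h 0) h0 hm1 hm => // a _; case: (h m).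
exists m, c; rewrite -hm; split=> // j.
  by have [/hm2//|/hn->] := leqP j n; case: (h m).
by move=> mj; have [/hm3->//|/hn->] := leqP j n; rewrite hm.
Qed.

End WithTopTheory.

(** * Weights of Hasse derivatives *)

Section TwistedWeight.
Variables (K : fieldType) (G : orderedGroupType) (nu : {poly K} -> with_top G).
Hypothesis nu0 : nu 0 = Inf.
Hypothesis nuM : forall f g, nu (f * g) = top_add (nu f) (nu g).
Hypothesis nuD : forall f g, Num.min (nu f) (nu g) <= nu (f + g).
Implicit Types f g q r Phi : {poly K}.

(** From [1 * 1 = 1] the finite value of [1] is 0, so twice the value of [-1] is 0, and an ordered
    group has no torsion. *)
Lemma nuN f : nu 1 <> Inf -> nu (- f) = nu f.
Proof.
move=> n1; have := nuM 1 1; rewrite mulr1.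
case E1 : (nu 1) n1 => [a|] // _ [] /esym/eqP.
rewrite -subr_eq0 addrK => /eqP a0; rewrite {a}a0 in E1.
have := nuM (-1) (-1); rewrite mulrNN mulr1 E1 => N1.
rewrite -mulN1r nuM; case: (nu (-1)) N1 => // b [b0].
have {}b0 : b = 0.
  by apply/eqP; rewrite eq_le -(ogrp_leMn 1) -(ogrp_leMn 1 0) mul0rn mulr2n -b0 lexx.
by rewrite b0; case: (nu f) => // c; rewrite /top_add add0r.
Qed.

Lemma nuD_lt f g : nu 1 <> Inf -> nu f < nu g -> nu (f + g) = nu f.
Proof.
move=> n1 fg; apply/eqP; rewrite eq_le.
have := nuD (f + g) (- g); rewrite addrK nuN // ge_min (leNgt (nu g)) fg orbF.
by move=> ->; have := nuD f g; rewrite min_l // ltW.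
Qed.

(** With [q] the quotient times [Phi], this reduces the key property to excluding that [nu q] is at
    most both other values. *)
Lemma nu_div_lt f q r : nu 1 <> Inf -> f = q + r ->
  nu q > Num.min (nu f) (nu r) -> nu f = nu r /\ nu r < nu q.
Proof.
move=> n1 ->; rewrite gt_min => /orP[lt|lt]; last first.
  by rewrite addrC nuD_lt.
have := @nuD_lt (q + r) (- q) n1; rewrite nuN // addrAC subrr add0r => /(_ lt) E.
by rewrite E lt.
Qed.

(** Multiplying by [n] keeps comparisons with [x / n] inside [G]. The index is separate from [f] so
    that it can add up under products. *)
Definition twist n x i f : with_top G :=
  if nu f is Fin y then Fin (y *+ n + x *+ i) else Inf.

Lemma twist0 n x i : twist n x i 0 = Inf.
Proof. by rewrite /twist nu0. Qed.

Lemma twist_le n x i f g : nu f <= nu g -> twist n x i f <= twist n x i g.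
Proof.
rewrite /twist; case: (nu f) (nu g) => [a|] [b|] // ab.
rewrite -[_ <= _]/(_ + _ <= _) ogrp_leD //.
by case: n => // n; rewrite ogrp_leMn.
Qed.

Lemma twist_gtD n x i c f g :
  c < twist n x i f -> c < twist n x i g -> c < twist n x i (f + g).
Proof.
move=> cf cg; have := nuD f g; rewrite ge_min => /orP[] /(@twist_le n x i).
  exact: lt_le_trans.
exact: lt_le_trans.
Qed.

Lemma twist_gt_sum n x i c (I : finType) (P : pred I) (F : I -> {poly K}) :
  (forall j, P j -> Fin c < twist n x i (F j)) ->
  Fin c < twist n x i (\sum_(j | P j) F j).
Proof.
move=> H; apply: (big_ind (fun f => Fin c < twist n x i f)) => //.
  by rewrite twist0.
by move=> f g; apply: twist_gtD.
Qed.

Lemma twistM n x i j f g :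
  twist n x (i + j) (f * g) = top_add (twist n x i f) (twist n x j g).
Proof.
rewrite /twist nuM; case: (nu f) (nu g) => [a|] [b|] //=.
by rewrite mulrnDl mulrnDr addrACA.
Qed.

(** Clearing denominators, [(y - z) / i < x / n] becomes [n y < n z + i x]. *)
Lemma slope_lt_twist f i x n y : nu f = Fin y -> (0 < i)%N -> (0 < n)%N ->
  slope nu f i < EFin (divfrac x n) -> Fin (y *+ n) < twist n x i f^`N(i).
Proof.
rewrite /slope /twist => -> i0 n0; case: (nu _) => // z.
rewrite !ltNge; apply: contra => le.
rewrite -[_ <= _]/(divfrac x n <= divfrac _ i) le_divfrac //.
by rewrite mulrnBl -(ogrp_leD2l (z *+ n)) [leRHS]addrC subrK.
Qed.

Lemma epsilon_attained f :
  epsilon nu f = NInf \/ exists2 i, (0 < i)%N & epsilon nu f = slope nu f i.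
Proof.
rewrite /epsilon big_nat.
apply: (big_ind (fun e => e = NInf \/ exists2 i, (0 < i)%N & e = slope nu f i)).
- by left.
- by move=> a b; rewrite maxEle; case: ifP.
- by move=> i /andP[i0 _]; right; exists i.
Qed.

Lemma slope_le_epsilon f i : (0 < i)%N -> slope nu f i <= epsilon nu f.
Proof.
move=> i0; have [fi|fi] := leqP (size f) i.
  by rewrite /slope nderivn_poly0 // nu0; case: (nu f).
by rewrite /epsilon le_bigmax_seq // mem_index_iota i0.
Qed.

(* The index is a sum [I + J] of last minimising indices: in the Leibniz
   formula every term but the one at [(I, J)] has a greater weight. *)
Lemma mul_twist_le q Phi n x J v w :
  nu q = Fin v -> nu Phi = Fin w -> (0 < J)%N ->
  twist n x J Phi^`N(J) <= twist n x 0 Phi ->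
  exists2 i, (0 < i)%N & twist n x i (q * Phi)^`N(i) <= Fin ((v + w) *+ n).
Proof.
move=> nq nP J0 JP.
have hmin f y : nu f = Fin y -> exists i c,
    [/\ twist n x i f^`N(i) = Fin c, Fin c <= Fin (y *+ n),
      forall j, Fin c <= twist n x j f^`N(j)
    & forall j, (i < j)%N -> Fin c < twist n x j f^`N(j)].
  move=> fy; have [||i [c [H1 H2 H3]]] :=
      @last_min _ (fun i => twist n x i f^`N(i)) (size f).
  - by rewrite nderivn0 /twist fy.
  - by move=> j /ltnW fj; rewrite nderivn_poly0 // twist0.
  exists i, c; split=> //.
  by have := H2 0; rewrite nderivn0 /twist fy mulr0n addr0.
have [a [c [ac cv cmin clt]]] := hmin _ _ nq.
have [b [d [bd dw dmin dlt]]] := hmin _ _ nP.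
(* If 0 were the last minimising index for [Phi], the weight at [J] would exceed the one at 0. *)
have b0 : (0 < b)%N.
  rewrite lt0n; apply/eqP => b0; have := dlt J; rewrite b0 => /(_ J0).
  by rewrite -bd b0 nderivn0 ltNge JP.
exists (a + b)%N; first by rewrite addn_gt0 b0 orbT.
have cd : Fin (c + d) <= Fin ((v + w) *+ n).
  by rewrite mulrnDl -[_ <= _]/(c + d <= _) ogrp_leD.
apply: le_trans cd; rewrite leNgt; apply/negP => gt.
have aab : (a < (a + b).+1)%N by rewrite ltnS leq_addr.
pose T (i : 'I_(a + b).+1) := q^`N(i) * Phi^`N(a + b - i).
have term : q^`N(a) * Phi^`N(b) =
    (q * Phi)^`N(a + b) + \sum_(i | i != Ordinal aab) - T i.
  rewrite nderivnM (bigD1 (Ordinal aab)) //= addKn sumrN addrK //.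
suff : Fin (c + d) < twist n x (a + b) (q^`N(a) * Phi^`N(b)).
  by rewrite twistM ac bd ltxx.
rewrite term; apply: twist_gtD => //; apply: twist_gt_sum => i ia.
have E : (i + (a + b - i) = a + b)%N by rewrite subnKC // -ltnS.
rewrite -mulNr -[in twist _ _ _]E twistM.
have n1 : nu 1 <> Inf.
  by move=> n1; have := nuM 1 q; rewrite mul1r n1 nq.
have -> : twist n x i (- q^`N(i)) = twist n x i q^`N(i).
  by rewrite /twist nuN.
(* Past [a] the first factor is above its minimum; before [a] the second index is past [b]. *)
have [ai|ai] := ltnP a i; first exact: top_add_lt_le (clt _ ai) (dmin _).
apply: top_add_le_lt (cmin _) (dlt _ _).
have : (i < a)%N by rewrite ltn_neqAle ai andbT.
lia.
Qed.

(** In each Leibniz term one of the two indices is positive and gives a strict inequality; the other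
    factor gives a weak one. *)
Lemma nderivnM_twist_lt f g n x v w :
  nu f = Fin v -> nu g = Fin w ->
  (forall i, (0 < i)%N -> Fin (v *+ n) < twist n x i f^`N(i)) ->
  (forall i, (0 < i)%N -> Fin (w *+ n) < twist n x i g^`N(i)) ->
  forall i, (0 < i)%N -> Fin ((v + w) *+ n) < twist n x i (f * g)^`N(i).
Proof.
move=> nf ng Hf Hg i i0; rewrite nderivnM mulrnDl; apply: twist_gt_sum => j _.
have E : (j + (i - j) = i)%N by rewrite subnKC // -ltnS.
rewrite -[in twist _ _ _]E twistM.
have [j0|j0] := posnP j.
  rewrite j0 subn0 nderivn0; apply: top_add_le_lt (Hg _ i0).
  by rewrite /twist nf mulr0n addr0.
apply: top_add_lt_le (Hf _ j0) _.
have [k0|k0] := posnP (i - j); last exact/ltW/Hg.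
by rewrite k0 nderivn0 /twist ng mulr0n addr0.
Qed.

(** The finiteness hypothesis is the common form of the valuation and pseudo-valuation cases. *)
Lemma abstract_key_is_key Phi :
  (forall f, f != 0 -> (size f <= size Phi)%N -> nu f <> Inf) ->
  abstract_key_polynomial nu Phi -> key_polynomial nu Phi.
Proof.
move=> finite [Phi1 Phim Phimin]; split=> // f g f0 g0 fP gP.
have fin (h : {poly K}) : h != 0 -> (size h <= size Phi)%N -> exists y, nu h = Fin y.
  by move=> h0 /(finite _ h0); case: (nu h) => // y; exists y.
have n1 : nu 1 <> Inf by apply: finite; rewrite ?oner_eq0 // size_poly1 ltnW.
have Phi0 : Phi != 0 by rewrite monic_neq0.
have [v nf] := fin f f0 (ltnW fP); have [w ng] := fin g g0 (ltnW gP).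
have [s nP] := fin Phi Phi0 (leqnn _).
set q := _ %/ Phi; set r := _ %% Phi.
have fgE : f * g = q * Phi + r := divp_eq _ _.
have rP : (size r < size Phi)%N by rewrite ltn_modp.
apply: (nu_div_lt n1 fgE); rewrite ltNge le_min; apply/negP => /andP[leq_fg leq_r].
have q0 : q != 0.
  by apply/eqP => q0; move: leq_fg; rewrite q0 mul0r nu0 nuM nf ng.
(* Both factors have degree below that of [Phi], hence so does [q]. *)
have [t nq] : exists t, nu q = Fin t.
  apply: fin => //; rewrite size_divp //.
  apply: leq_trans (leq_sub2r _ (size_mul_leq f g)) _.
  by move: (size f) (size g) (size Phi) fP gP => a b d; lia.
(* The top Hasse derivative of the monic [Phi] is 1, whose value is finite. *)
have eN : epsilon nu Phi <> NInf.
  move=> eN; have := @slope_le_epsilon Phi (size Phi).-1; rewrite eN /slope nP.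
  rewrite -subn1 subn_gt0 => /(_ Phi1).
  have -> : Phi^`N(size Phi - 1) = 1.
    apply/polyP => i; rewrite coef_nderivn coef1.
    case: i => [|i]; last first.
      by rewrite nth_default ?mul0rn //; move: (size Phi) Phi1 => d; lia.
    by rewrite addn0 binn subn1 -lead_coefE (monicP Phim).
  by case: (nu 1) n1.
have [x [n [J [n0 J0 eE JE]]]] : exists x n J, [/\ (0 < n)%N, (0 < J)%N,
    epsilon nu Phi = EFin (divfrac x n)
  & twist n x J Phi^`N(J) <= twist n x 0 Phi].
  case: (epsilon_attained Phi) => [/eN//|[J J0 eJ]].
  move: eN; rewrite eJ /slope nP; case E : (nu _) => [z|] // _.
  (* [J] attains the maximum [(s - z) / J], so the weights at [J] and at 0 are both [J s]. *)
  exists (s - z), J, J; split=> //.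
  rewrite /twist E nP mulr0n addr0 -[_ <= _]/(_ + _ <= _).
  by rewrite mulrnBl addrC subrK.
(* Minimality of the degree of [Phi] forces the epsilon of [h] strictly below that of [Phi]. *)
have small (h : {poly K}) y : h != 0 -> (size h < size Phi)%N -> nu h = Fin y ->
    forall i, (0 < i)%N -> Fin (y *+ n) < twist n x i h^`N(i).
  move=> h0 hP hy i i0; apply: slope_lt_twist => //; rewrite -eE.
  apply: le_lt_trans (slope_le_epsilon h i0) _; rewrite ltNge.
  by apply: contraL hP => /(Phimin _ h0); rewrite leqNgt.
have [i i0] := mul_twist_le nq nP J0 JE; apply/negP; rewrite -ltNge.
have -> : (q * Phi)^`N(i) = (f * g)^`N(i) + (- r)^`N(i).
  by rewrite fgE -nderivnD addrK.
move: leq_fg leq_r; rewrite !nuM nf ng nq nP => leq_fg leq_r.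
have mono a b : Fin a <= Fin b -> Fin (a *+ n) <= Fin (b *+ n) :> with_top G.
  by case: n n0 {eE JE small} => // n _ ab; rewrite -[_ <= _]/(_ *+ _ <= _ *+ _) ogrp_leMn.
apply: twist_gtD.
  apply: le_lt_trans (mono _ _ leq_fg) _.
  exact: (nderivnM_twist_lt nf ng (small _ _ f0 fP nf) (small _ _ g0 gP ng)).
rewrite nderivnN /twist nuN // -/(twist n x i _).
(* [small] needs a nonzero polynomial; a zero remainder has infinite weight. *)
have [->|r0] := eqVneq r 0; first by rewrite linear0 twist0.
have [y ny] := fin r r0 (ltnW rP); rewrite ny in leq_r.
exact: le_lt_trans (mono _ _ leq_r) (small _ _ r0 rP ny _ i0).
Qed.

End TwistedWeight.

(** * The support ideal and the two cases of the theorem *)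

(** A nonzero element of least degree in the support divides all others, by euclidean division. *)
Lemma exists_support_generator (K : fieldType) (G : orderedGroupType)
    (nu : {poly K} -> with_top G) (f : {poly K}) :
  pseudo_valuation nu -> f != 0 -> nu f = Inf ->
  exists g, [/\ generates_support nu g, g != 0 & (size g <= size f)%N].
Proof.
move=> [_ nu0 nuM nuD] f0 nf.
have nuI g h : nu g = Inf -> nu (g * h) = Inf by rewrite nuM => ->.
pose P m := `[< exists g, [/\ nu g = Inf, g != 0 & size g = m] >].
have exP : exists m, P m by exists (size f); apply/asboolP; exists f.
case: (ex_minnP exP) => m /asboolP[g [ng g0 gm]] min.
exists g; split=> //; last by rewrite gm min //; apply/asboolP; exists f.
move=> h; split=> [nh|/dvdpP[k ->]]; last by rewrite mulrC nuI.
have nr : nu (h %% g) = Inf.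
  have -> : h %% g = h - h %/ g * g by rewrite {2}(divp_eq h g) addrC addKr.
  have := nuD h (- (h %/ g * g)); rewrite -mulNr mulrC nh nuI //.
  by rewrite minxx; case: (nu _).
apply/modp_eq0P/eqP; apply: contraTT (ltn_modpN0 h g0) => r0; rewrite -leqNgt gm min //.
by apply/asboolP; exists (h %% g).
Qed.

Theorem corollary5p3 (K : fieldType) (G : orderedGroupType) :
  (forall w : {fraction {poly K}} -> with_top G,
     valuation w ->
     finite_rank (base_value_group (restrict_to_poly w)) ->
     forall Phi : {poly K},
       abstract_key_polynomial (restrict_to_poly w) Phi ->
       key_polynomial (restrict_to_poly w) Phi)
  /\
  (forall nu : {poly K} -> with_top G,
     pseudo_valuation nu ->
     finite_rank (base_value_group nu) ->
     forall Phi : {poly K},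
       (forall g : {poly K},
          generates_support nu g -> g != 0 -> (size Phi < size g)%N) ->
       abstract_key_polynomial nu Phi ->
       key_polynomial nu Phi).
Proof.
split=> [w [[_ w0 wM wD] winf] _ Phi|nu nuP _ Phi Psmall].
  apply: abstract_key_is_key => [|f g|f g|f f0 _ /winf/eqP].
  - by rewrite /restrict_to_poly tofrac0.
  - by rewrite /restrict_to_poly tofracM.
  - by rewrite /restrict_to_poly tofracD.
  - by rewrite tofrac_eq0 (negPf f0).
have [_ nu0 nuM nuD] := nuP.
(* A nonzero [f] of infinite value and degree at most that of [Phi] would yield a generator of no
   larger degree. *)
apply: abstract_key_is_key => // f f0 fPhi /(exists_support_generator nuP f0).
move=> [g [/Psmall gP /gP Pg gf]].
by have := leq_trans Pg (leq_trans gf fPhi); rewrite ltnn.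
Qed.
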